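(* Fix $\sigma>0$ and a constant $C$. For each $n$ let $G$ be a graph with $n$ vertices and $G'$ a graph with $n'$ vertices, and assume that $G'$ can be obtained from $G$ by at most $C$ steps of edit operations, where $C$ is independent of $n$. Then $D(G,G')=\mathcal{O}(1/n)$ as $n\to\infty$.
   Context: All graphs are simple: finite, undirected, unweighted, without self-loops or multiple edges (not necessarily connected). For a graph $G=(V,E)$ with $n$ vertices, the normalized Laplacian acts on functions $f:V\to\mathbb{R}$ by $\Delta_G f(x)=f(x)-\frac{1}{d_x}\sum_{y\sim x}f(y)$, where $d_x$ is the degree of $x$; at an isolated vertex $x$ one sets $\Delta_G f(x)=0$, so each isolated vertex contributes an eigenvalue $0$. The spectrum consists of $n$ real eigenvalues (with multiplicity) $0=\lambda_0\le\lambda_1\le\cdots\le\lambda_{n-1}\le 2$. For a fixed bandwidth $\sigma>0$ (the same for all graphs), let $\rho_G(x)=\frac1n\sum_{i=0}^{n-1}\frac{1}{\sqrt{2\pi\sigma^2}}e^{-\frac{(x-\lambda_i)^2}{2\sigma^2}}$ for $x\in\mathbb{R}$. The spectral distance of graphs $G,G'$ is $D(G,G')=\int_{\mathbb{R}}|\rho_G(x)-\rho_{G'}(x)|\,dx$. An edit operation on a graph is the insertion or deletion of an edge, or the insertion or deletion of an isolated vertex. *)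

(* Defs.v *)
From mathcomp Require Import all_boot all_order all_algebra.
From mathcomp Require Import polyrcf.
From mathcomp Require Import all_classical all_reals all_analysis.

Set Implicit Arguments.
Unset Strict Implicit.
Unset Printing Implicit Defensive.

Import Order.TTheory GRing.Theory Num.Theory.
Import numFieldNormedType.Exports.

Local Open Scope ring_scope.

Record sgraph := SGraph {
  vertex :> finType;
  edge : rel vertex;
  edge_sym : symmetric edge;
  edge_irrefl : irreflexive edge
}.

Definition degree (G : sgraph) (x : G) : nat := #|[set y | edge x y]|.

Definition graph_iso (G H : sgraph) : Prop :=
  exists f : G -> H, bijective f /\ forall x y, edge (f x) (f y) = edge x y.

(* Vertex sets are arbitrary finite types, so the result of an edit operation
   is only meaningful up to isomorphism. *)

Definition edge_insertion (G H : sgraph) : Prop :=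
  exists (a b : G) (f : G -> H),
    [/\ a != b, ~~ edge a b, bijective f &
      forall x y, edge (f x) (f y) =
        [|| edge x y, (x == a) && (y == b) | (x == b) && (y == a)]].

(* [None] is the new isolated vertex. *)
Definition isolated_vertex_insertion (G H : sgraph) : Prop :=
  exists f : option G -> H, bijective f /\
    forall u v, edge (f u) (f v) =
      (if (u, v) is (Some x, Some y) then edge x y else false).

Definition edit_step (G H : sgraph) : Prop :=
  [\/ edge_insertion G H,
      edge_insertion H G,
      isolated_vertex_insertion G H |
      isolated_vertex_insertion H G].

Fixpoint edit_steps (k : nat) (G H : sgraph) : Prop :=
  if k is k'.+1 then exists2 K : sgraph, edit_step G K & edit_steps k' K H
  else graph_iso G H.

Definition edit_within (C : nat) (G H : sgraph) : Prop :=
  exists2 k : nat, (k <= C)%N & edit_steps k G H.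

Section Spectrum.
Variable R : realType.
Implicit Types G : sgraph.

Definition laplacian G (f : G -> R) (x : G) : R :=
  if degree x == 0%N then 0
  else f x - (degree x)%:R^-1 * \sum_(y | edge x y) f y.

(* The matrix of [laplacian G] in the basis of indicator functions. *)
Definition laplacian_mx G : 'M[R]_#|G| :=
  \matrix_(i, j) laplacian (fun y : G => (y == enum_val j)%:R) (enum_val i).

(* The nondecreasing list of real roots of p, repeated with multiplicity. *)
Definition roots_with_mult (p : {poly R}) : seq R :=
  flatten [seq nseq (mup a p) a | a <- rootsR p].

Definition spectrum G : seq R := roots_with_mult (char_poly (laplacian_mx G)).

(* For s > 0, [normal_pdf a s x] is exp(-(x - a)^2 / (2 s^2)) / sqrt(2 pi s^2). *)
Definition spectral_density (s : R) G (x : R) : R :=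
  #|G|%:R^-1 * \sum_(a <- spectrum G) normal_pdf a s x.

Definition spectral_distance (s : R) G G' : R :=
  \int[@lebesgue_measure R]_x `|spectral_density s G x - spectral_density s G' x|.

End Spectrum.

(* Main.v *)
Require Import Defs.
From mathcomp Require Import all_boot all_order all_algebra.
From mathcomp Require Import complex polyrcf zify ring lra.
From mathcomp Require Import all_classical all_reals all_analysis.
From mathcomp Require Import measurable_realfun.
Import Order.TTheory GRing.Theory Num.Theory.
Import numFieldNormedType.Exports.
Local Open Scope ring_scope.

(** The normalized Laplacian of G is similar to the symmetric matrix with
    diagonal entries 1 (0 at isolated vertices) and entries
    -1 / sqrt (d_x d_y) at the edges.  Away from the two endpoints of an
    inserted edge neither degrees nor adjacency change, and an isolated vertex
    only adds a zero row and a zero column.  So the matrices of two graphs one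
    edit apart have a common principal submatrix of size at least the number of
    vertices minus two.  Cauchy interlacing, in the form of a dimension count
    ([interlacing_count]), then says that for every t the numbers of
    eigenvalues below t differ by at most 2 ([edit_step_close]).  These bounds
    add up along a sequence of edits, so after C edits the numbers of
    eigenvalues in any closed interval differ by at most 4 C.

    Fix x.  As a function of the eigenvalue a, the Gaussian density centred at
    a and evaluated at x has intervals as superlevel sets.  A sum of values is
    determined by the cardinals of superlevel sets, so the Gaussian sums over
    the two spectra differ at x by at most a constant times the largest
    Gaussian value that occurs ([sum_le_of_level_counts]).  All eigenvalues
    lie in [-2, 2] ([spectrum_bounded]), hence this value is at most a fixed
    multiple of one wider Gaussian, which is integrable
    ([normal_pdf_le_majorant]).  The normalizations 1/n and 1/n' contribute
    another error of the same kind, since |n - n'| is bounded.  Integrating the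
    pointwise bound O(1/n) times the wide Gaussian gives the result
    ([spectral_distance_le]). *)

(** * Interlacing for compressions of Hermitian matrices *)

Section Interlacing.
Set Implicit Arguments.
Unset Strict Implicit.
Variable C : numClosedFieldType.
Local Open Scope sesquilinear_scope.

Lemma wide_system_solvable p q (B : 'M[C]_(p, q)) : (q < p)%N ->
  exists2 f : 'rV_p, f != 0 & f *m B = 0.
Proof.
move=> ltqp; have : kermx B != 0.
  rewrite kermx_eq0 /row_free neq_ltn (leq_ltn_trans (rank_leq_col B)) //.
by case/rowV0Pn=> f /sub_kermxP fB f0; exists f.
Qed.

Lemma diag_formE m (d c : 'rV[C]_m) :
  (c *m diag_mx d *m c^t*) 0 0 = \sum_i d 0 i * `|c 0 i| ^+ 2.
Proof.
rewrite mxE; apply: eq_bigr => i _.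
by rewrite mul_mx_diag !mxE normCK mulrA (mulrC (d 0 i)).
Qed.

(** Cauchy interlacing as a dimension count.  A and A' are isometric
    embeddings of p-space, written in eigenbases of two Hermitian matrices with
    eigenvalues l and l', whose compressions to p-space agree.  If the
    inequality failed, some nonzero f would lie, through A, in the span of the
    eigenvectors with eigenvalue at most t and, through A', in the span of
    those with eigenvalue above t.  The common quadratic form minus t |f|^2
    would then be nonpositive and positive at f. *)
Lemma interlacing_count p m m' (A : 'M[C]_(p, m)) (A' : 'M[C]_(p, m'))
    (l : 'rV[C]_m) (l' : 'rV[C]_m') (t : C) :
  A \is unitarymx -> A' \is unitarymx ->
  A *m diag_mx l *m A^t* = A' *m diag_mx l' *m A'^t* ->
  (p + #|[set i | (l 0 i <= t)%R]| + #|[set j | (t < l' 0 j)%R]| <= m + m')%N.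
Proof.
move=> /unitarymxP uA /unitarymxP uA' eqAA'.
set I := [set i | _]; set J := [set j | _].
rewrite leqNgt; apply/negP => ltmm'.
(* f is orthogonal to the other eigenvectors on both sides: there are
   m - #|I| + m' - #|J| < p such equations. *)
have [|f f0] := @wide_system_solvable _ _ (row_mx
  (colsub (fun i : 'I_#|~: I| => enum_val i) A)
  (colsub (fun j : 'I_#|~: J| => enum_val j) A')).
  have := cardsC I; have := cardsC J; rewrite !card_ord; lia.
rewrite mul_mx_row -[0]hsubmxK => /eq_row_mx[fA fA'].
pose c := f *m A; pose c' := f *m A'.
have c0 i : i \notin I -> c 0 i = 0.
  move=> iI; have iI' : i \in ~: I by rewrite inE.
  move/matrixP/(_ 0 (enum_rank_in iI' i)): fA.
  by rewrite mulmx_colsub !mxE enum_rankK_in // => <-.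
have c'0 j : j \notin J -> c' 0 j = 0.
  move=> iI; have iI' : j \in ~: J by rewrite inE.
  move/matrixP/(_ 0 (enum_rank_in iI' j)): fA'.
  by rewrite mulmx_colsub !mxE enum_rankK_in // => <-.
have shiftE q (B : 'M[C]_(p, q)) (d : 'rV_q) : B *m B^t* = 1%:M ->
    f *m B *m diag_mx (d - const_mx t) *m (f *m B)^t* =
    f *m (B *m diag_mx d *m B^t* - t%:M) *m f^t*.
  move=> uB; rewrite trmx_mul map_mxM !mulmxA -!(mulmxA f); congr (_ *m (_ *m _)).
  have -> : diag_mx (d - const_mx t) = diag_mx d - t%:M.
    by apply/matrixP => i j; rewrite !mxE mulrnBl.
  rewrite mulmxBr mulmxBl.
  by rewrite mul_mx_scalar -scalemxAl uB scalemx1.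
have cE : c *m diag_mx (l - const_mx t) *m c^t* =
          c' *m diag_mx (l' - const_mx t) *m c'^t*.
  by rewrite !shiftE // eqAA'.
have := congr1 (fun M => fun_of_matrix M 0 0) cE; rewrite /= !diag_formE => sumE.
have subE q (d : 'rV[C]_q) j : (d - const_mx t) 0 j = d 0 j - t by rewrite !mxE.
have le0 : \sum_i (l - const_mx t) 0 i * `|c 0 i| ^+ 2 <= 0.
  apply: sumr_le0 => i _; have [iI|/c0->] := boolP (i \in I); last first.
    by rewrite normr0 expr0n mulr0.
  by rewrite mulr_le0_ge0 ?exprn_ge0 //; move: iI; rewrite subE inE subr_le0.
have ge0 j : true -> 0 <= (l' - const_mx t) 0 j * `|c' 0 j| ^+ 2.
  move=> _; have [jJ|/c'0->] := boolP (j \in J); last first.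
    by rewrite normr0 expr0n mulr0.
  by rewrite mulr_ge0 ?exprn_ge0 //; move: jJ; rewrite subE inE subr_ge0 => /ltW.
have /eqP : \sum_j (l' - const_mx t) 0 j * `|c' 0 j| ^+ 2 = 0.
  by apply: le_anti; rewrite -{1}sumE le0 sumr_ge0.
rewrite psumr_eq0 // => /allP c'J.
have c'_eq0 : c' = 0.
  apply/matrixP => i j; rewrite ord1 [RHS]mxE.
  have [jJ|/c'0 //] := boolP (j \in J).
  have := c'J j (mem_index_enum _).
  rewrite mulf_eq0 sqrf_eq0 normr_eq0 subE /=.
  by move: jJ; rewrite inE subr_eq0 => ltj; rewrite (gt_eqF ltj) => /eqP.
by move: f0; rewrite -[f]mulmx1 -uA' mulmxA -/c' c'_eq0 mul0mx eqxx.
Qed.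

End Interlacing.

(** * Spectra of real symmetric matrices *)

Section CharPoly.
Set Implicit Arguments.
Unset Strict Implicit.

Lemma char_poly_similar (F : comNzRingType) n (A P Q : 'M[F]_n) :
  Q *m P = 1%:M -> char_poly (Q *m A *m P) = char_poly A.
Proof.
move=> QP; have QPX : map_mx polyC Q *m map_mx polyC P = 1%:M.
  by rewrite -map_mxM QP map_mx1.
rewrite /char_poly /char_poly_mx !map_mxM.
have -> : 'X%:M - map_mx polyC Q *m map_mx polyC A *m map_mx polyC P =
          map_mx polyC Q *m ('X%:M - map_mx polyC A) *m map_mx polyC P.
  by rewrite mulmxBr mulmxBl mul_mx_scalar -scalemxAl QPX scalemx1.
by rewrite !det_mulmx mulrAC -det_mulmx QPX det1 mul1r.
Qed.

Lemma char_poly_diag (F : comNzRingType) n (d : 'rV[F]_n) :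
  char_poly (diag_mx d) = \prod_i ('X - (d 0 i)%:P).
Proof.
rewrite char_poly_trig ?diag_mx_is_trig //.
by apply: eq_bigr => i _; rewrite mxE eqxx mulr1n.
Qed.

End CharPoly.

Section SymmetricSpectrum.
Set Implicit Arguments.
Unset Strict Implicit.
Local Open Scope sesquilinear_scope.
Variable R : realType.
Local Notation toC := (real_complex R).
Local Notation toCmx := (map_mx toC).

(** For a polynomial that splits, the multiplicities seen by [mup] recover
    every factor, so no eigenvalue escapes the list of real roots. *)
Lemma perm_roots_with_mult_prod (s : seq R) :
  perm_eq (roots_with_mult (\prod_(a <- s) ('X - a%:P))) s.
Proof.
set p := \prod_(a <- s) _; have p0 : p != 0.
  by rewrite monic_neq0 // monic_prod_XsubC.
apply/allP => a _ /=; apply/eqP.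
rewrite /roots_with_mult count_flatten -map_comp sumnE big_map.
have rootsE b : (b \in rootsR p) = root p b.
  by rewrite -(roots_on_rootsR p0) in_itv.
under eq_bigr do rewrite /= count_nseq /=.
rewrite -(mu_prod_XsubC a s) -/p.
have [pa|pa] := boolP (root p a).
  rewrite (bigD1_seq a) ?uniq_roots ?rootsE //= eqxx mul1n big1 ?addn0 //.
  by move=> b /negPf ->.
rewrite mupNroot // big1_seq // => b /andP[_]; rewrite rootsE => pb.
by case: eqVneq => // ba; rewrite -ba pb in pa.
Qed.

(** The spectral theorem is applied over the complex numbers, where
    eigenvectors are available; the eigenvalues of a Hermitian matrix being
    real, the characteristic polynomial splits already over R. *)
Lemma symmetric_spectral_decomposition n (A : 'M[R]_n) : A^T = A ->
  exists (l : 'rV[R]_n) (P : 'M[R[i]]_n),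
    [/\ P \is unitarymx,
        toCmx A = P^t* *m diag_mx (toCmx l) *m P &
        perm_eq (roots_with_mult (char_poly A)) [seq l 0 i | i : 'I_n]].
Proof.
move=> symA; have hermA : toCmx A \is hermsymmx.
  apply: realsym_hermsym.
    by apply/is_hermitianmxP; rewrite expr0 scale1r map_mx_id // map_trmx symA.
  by apply/mxOverP => i j; rewrite mxE; apply/complex_realP; exists (A i j).
pose P := spectralmx (toCmx A); have uP : P \is unitarymx := spectral_unitarymx _.
pose l : 'rV[R]_n := map_mx (@complex.Re R) (spectral_diag (toCmx A)).
have lE : toCmx l = spectral_diag (toCmx A).
  apply/rowP => i; rewrite !mxE RRe_real //.
  by have /mxOverP -> := hermitian_spectral_diag_real hermA.
have AE : toCmx A = P^t* *m diag_mx (toCmx l) *m P.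
  have /orthomx_spectralP := hermitian_normalmx hermA.
  by rewrite lE -invmx_unitary.
exists l, P; split=> //.
suff -> : char_poly A = \prod_(a <- [seq l 0 i | i : 'I_n]) ('X - a%:P).
  exact: perm_roots_with_mult_prod.
apply: (map_poly_inj toC); rewrite map_char_poly AE char_poly_similar; last first.
  by rewrite -invmx_unitary // mulVmx // unitarymx_unit.
rewrite char_poly_diag map_prod_XsubC big_map big_enum /=.
by apply: eq_bigr => i _; rewrite mxE.
Qed.

(** One-sided closeness of two spectra.  Both the closed and the open
    half-lines are needed to count the points of closed intervals
    ([count_segment_le]). *)
Definition count_below_le (K : nat) (s s' : seq R) : Prop := forall t : R,
  (count (fun a => (a <= t)%R) s <= count (fun a => (a <= t)%R) s' + K)%N /\
  (count (fun a => (a < t)%R) s <= count (fun a => (a < t)%R) s' + K)%N.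

Lemma count_codom (n : nat) (l : 'rV[R]_n) (q : pred R) :
  count q [seq l 0 i | i : 'I_n] = #|[set i | q (l 0 i)]|.
Proof.
rewrite -sum1_count big_map big_enum_cond -sum1_card.
by apply: eq_bigl => i; rewrite inE.
Qed.

Lemma size_roots_symmetric n (A : 'M[R]_n) : A^T = A ->
  size (roots_with_mult (char_poly A)) = n.
Proof.
move=> /symmetric_spectral_decomposition[l [P [_ _ /perm_size->]]].
by rewrite size_map size_enum_ord.
Qed.

(** Cauchy interlacing for symmetric matrices with a common principal
    submatrix.  The dimension count bounds the eigenvalues of A up to t
    together with those of A' above t by m + m' - p; since A' has m'
    eigenvalues in all, m' cancels. *)
Lemma compression_count_below p m m' (A : 'M[R]_m) (A' : 'M[R]_m')
    (e : 'I_p -> 'I_m) (e' : 'I_p -> 'I_m') :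
  injective e -> injective e' -> A^T = A -> A'^T = A' ->
  (forall x y, A (e x) (e y) = A' (e' x) (e' y)) ->
  count_below_le (m - p) (roots_with_mult (char_poly A))
                         (roots_with_mult (char_poly A')).
Proof.
move=> inje inje' symA symA' eqA.
have [l [P [uP AE sE]]] := symmetric_spectral_decomposition symA.
have [l' [P' [uP' AE' sE']]] := symmetric_spectral_decomposition symA'.
pose E n (f : 'I_p -> 'I_n) : 'M[R[i]]_(p, n) := rowsub f 1%:M.
have EE n (f : 'I_p -> 'I_n) (M : 'M[R[i]]_n) :
    E n f *m M *m (E n f)^t* = mxsub f f M.
  rewrite /E mul_rowsub_mx mul1mx trmx_mxsub trmx1 map_mxsub map_mx1 mulmx_colsub.
  by rewrite mulmx1 -mxsub_comp.
have uE n (f : 'I_p -> 'I_n) : injective f -> E n f \is unitarymx.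
  move=> injf; apply/unitarymxP; rewrite -[E n f in X in X *m _]mulmx1 EE.
  by apply/matrixP => x y; rewrite !mxE inj_eq.
pose B := E m e *m P^t*; pose B' := E m' e' *m P'^t*.
have uB : B \is unitarymx by rewrite mul_unitarymx ?uE // trmxC_unitary.
have uB' : B' \is unitarymx by rewrite mul_unitarymx ?uE // trmxC_unitary.
have BE : B *m diag_mx (toCmx l) *m B^t* = B' *m diag_mx (toCmx l') *m B'^t*.
  have conjE n (F : 'M[R[i]]_(p, n)) (Q D : 'M[R[i]]_n) :
      F *m Q^t* *m D *m (F *m Q^t*)^t* = F *m (Q^t* *m D *m Q) *m F^t*.
    by rewrite trmx_mul map_mxM trmxCK !mulmxA.
  by rewrite !conjE -AE -AE' !EE; apply/matrixP => x y; rewrite !mxE eqA.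
have sz' : count xpredT [seq l' 0 i | i : 'I_m'] = m'.
  by rewrite count_predT size_map size_enum_ord.
move=> t; rewrite !(permP sE) !(permP sE'); split.
  have := interlacing_count (toC t) uB uB' BE.
  have := count_predC (fun a => a <= t) [seq l' 0 i | i : 'I_m'].
  rewrite -(count_predT [seq _ | _ in _]) sz' !count_codom.
  have -> : [set i | (toCmx l) 0 i <= toC t] = [set i | l 0 i <= t].
    by apply/setP => i; rewrite !inE mxE lecR.
  have -> : [set i | toC t < (toCmx l') 0 i] = [set i | predC (fun a => a <= t) (l' 0 i)].
    by apply/setP => i; rewrite !inE mxE ltcR ltNge.
  lia.
(* The open half-line is obtained from the closed one by negating both
   matrices and exchanging their roles. *)
have BEN : B' *m diag_mx (- toCmx l') *m B'^t* = B *m diag_mx (- toCmx l) *m B^t*.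
  have dN n (d : 'rV[R[i]]_n) : diag_mx (- d) = - diag_mx d.
    by apply/matrixP => i j; rewrite !mxE mulNrn.
  by rewrite !dN !mulmxN !mulNmx BE.
have := interlacing_count (- toC t) uB' uB BEN.
have := count_predC (fun a => a < t) [seq l' 0 i | i : 'I_m'].
rewrite -(count_predT [seq _ | _ in _]) sz' !count_codom.
have -> : [set i | - toC t < (- toCmx l) 0 i] = [set i | l 0 i < t].
  by apply/setP => i; rewrite !inE !mxE ltrN2 ltcR.
have -> : [set i | (- toCmx l') 0 i <= - toC t] =
          [set i | predC (fun a => a < t) (l' 0 i)].
  by apply/setP => i; rewrite !inE !mxE lerN2 lecR leNgt.
lia.
Qed.

End SymmetricSpectrum.

(** * The normalized Laplacian under edit operations *)

Section GraphSpectrum.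
Set Implicit Arguments.
Unset Strict Implicit.
Variable R : realType.
Implicit Types G H : sgraph.

Lemma laplacian_mxE G (x y : G) :
  laplacian_mx R G (enum_rank x) (enum_rank y) =
  if degree x == 0%N then 0
  else (x == y)%:R - (degree x)%:R^-1 * (edge x y)%:R.
Proof.
rewrite mxE !enum_rankK /laplacian; case: ifP => // _; congr (_ - _ * _).
have [xy|xy] := boolP (edge x y).
  rewrite (bigD1 y) //= eqxx big1 ?addr0 // => z /andP[_ /negPf->] //.
rewrite big1 // => z xz; case: eqVneq => // zy.
by rewrite -zy xz in xy.
Qed.

Lemma degree_gt0 G (x y : G) : edge x y -> (0 < degree x)%N.
Proof. by move=> xy; apply/card_gt0P; exists y; rewrite inE. Qed.

(** Square roots of the degrees, set to 1 at isolated vertices so that they can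
    be used as a change of basis. *)
Definition degree_weight G (x : G) : R :=
  if degree x == 0%N then 1 else Num.sqrt (degree x)%:R.

Lemma degree_weight_neq0 G (x : G) : degree_weight x != 0.
Proof.
rewrite /degree_weight; case: ifPn => [_|d0]; first exact: oner_neq0.
by rewrite sqrtr_eq0 -ltNge ltr0n lt0n.
Qed.

(** The conjugate of the Laplacian that makes it symmetric, since the
    Laplacian is self-adjoint for the inner product weighted by degrees. *)
Definition sym_laplacian_mx G : 'M[R]_#|G| :=
  \matrix_(i, j) (degree_weight (enum_val i) * laplacian_mx R G i j /
                  degree_weight (enum_val j)).

Lemma sym_laplacian_mxE G (x y : G) :
  sym_laplacian_mx G (enum_rank x) (enum_rank y) =
  (degree x != 0%N)%:R * (x == y)%:R -
  (edge x y)%:R / (Num.sqrt (degree x)%:R * Num.sqrt (degree y)%:R).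
Proof.
rewrite mxE !enum_rankK laplacian_mxE.
have w0 (z : G) := degree_weight_neq0 z.
case: ifP => [/eqP dx|dx].
  rewrite mul0r mulr0 mul0r /=; have [/degree_gt0|_] := boolP (edge x y).
    by rewrite dx.
  by rewrite !mul0r subr0.
rewrite mul1r mulrBr mulrBl; congr (_ - _).
  by case: eqVneq => [->|_]; rewrite ?mulr1 ?divff // mulr0 mul0r.
have [xy|_] := boolP (edge x y); last by rewrite !(mulr0, mul0r).
have dy : (degree y == 0%N) = false.
  by apply/negbTE; rewrite -lt0n (@degree_gt0 _ y x) // edge_sym.
have := w0 x; rewrite mulr1 mul1r /degree_weight dx dy => wx0.
rewrite invfM; congr (_ / _).
by rewrite -[X in X^-1]sqr_sqrtr // expr2 invfM mulrA divff // mul1r.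
Qed.

Lemma sym_laplacian_mx_tr G : (sym_laplacian_mx G)^T = sym_laplacian_mx G.
Proof.
apply/matrixP => i j; rewrite mxE -(enum_valK i) -(enum_valK j).
rewrite !sym_laplacian_mxE edge_sym [_ * Num.sqrt _]mulrC [_ == enum_val i]eq_sym.
by case: (enum_val i =P enum_val j) => [->|_] //; rewrite !mulr0.
Qed.

Lemma spectrumE G : spectrum R G = roots_with_mult (char_poly (sym_laplacian_mx G)).
Proof.
rewrite /spectrum; congr roots_with_mult.
pose w : 'rV[R]_#|G| := \row_i degree_weight (enum_val i).
pose w' : 'rV[R]_#|G| := \row_i (degree_weight (enum_val i))^-1.
have ww' : diag_mx w *m diag_mx w' = 1%:M.
  rewrite mulmx_diag -diag_const_mx; congr diag_mx.
  by apply/rowP => i; rewrite !mxE divff ?degree_weight_neq0.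
rewrite -(char_poly_similar (laplacian_mx R G) ww'); congr char_poly.
by apply/matrixP => i j; rewrite mul_mx_diag mul_diag_mx !mxE.
Qed.

Lemma size_spectrum G : size (spectrum R G) = #|G|.
Proof. by rewrite spectrumE size_roots_symmetric // sym_laplacian_mx_tr. Qed.

Lemma laplacian_row_norm G (i : 'I_#|G|) : \sum_j `|laplacian_mx R G i j| <= 2.
Proof.
rewrite -(enum_valK i); set x := enum_val i.
rewrite (reindex (@enum_rank G)) /=; last first.
  by exists enum_val => ? _; rewrite ?enum_rankK ?enum_valK.
under eq_bigr do rewrite laplacian_mxE.
have [_|dx] := eqVneq (degree x) 0%N.
  by rewrite big1 // => y _; rewrite normr0.
have dx0 : 0 < (degree x)%:R :> R by rewrite ltr0n lt0n.
apply: (@le_trans _ _ (\sum_y ((x == y)%:R + (degree x)%:R^-1 * (edge x y)%:R))).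
  apply: ler_sum => y _; apply: le_trans (ler_normB _ _) _.
  by rewrite !ger0_norm // mulr_ge0 ?invr_ge0.
rewrite big_split /= -mulr_sumr -!natr_sum.
have -> : (\sum_y (x == y))%N = 1%N.
  by rewrite (bigD1 x) //= eqxx big1 // => y /negPf; rewrite eq_sym => ->.
have -> : (\sum_y edge x y)%N = degree x by rewrite /degree -sum1dep_card [RHS]big_mkcond.
by rewrite mulVf ?gt_eqF.
Qed.

(** A left eigenvector v satisfies |a| |v|_1 <= 2 |v|_1, because the rows of the
    Laplacian have l1-norm at most 2.  The bound is the same for all graphs. *)
Lemma spectrum_bounded G (a : R) : a \in spectrum R G -> `|a| <= 2.
Proof.
rewrite /spectrum /roots_with_mult => /flattenP[s /mapP[b bL ->]].
rewrite mem_nseq => /andP[_ /eqP->] {a s}.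
have {bL} : root (char_poly (laplacian_mx R G)) b.
  by rewrite -(roots_on_rootsR (monic_neq0 (char_poly_monic _))) in bL; case/andP: bL.
rewrite -eigenvalue_root_char => /eigenvalueP[v vL v0].
have v_gt0 : 0 < \sum_i `|v 0 i|.
  rewrite lt_neqAle sumr_ge0 // andbT eq_sym psumr_eq0 //.
  apply: contraNN v0 => /allP v0; apply/eqP/rowP => i; apply/eqP; rewrite mxE.
  by rewrite -normr_eq0; exact: v0 (mem_index_enum _).
rewrite -(ler_pM2r v_gt0) mulr_sumr.
under eq_bigr => i _.
  rewrite -normrM (_ : b * v 0 i = (v *m laplacian_mx R G) 0 i); last by rewrite vL mxE.
  rewrite mxE; over.
apply: (@le_trans _ _ (\sum_i \sum_j `|v 0 j| * `|laplacian_mx R G j i|)).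
  apply: ler_sum => i _; apply: le_trans (ler_norm_sum _ _ _) _.
  by apply: ler_sum => j _; rewrite normrM.
rewrite exchange_big mulr_sumr; apply: ler_sum => j _ /=.
by rewrite -mulr_sumr mulrC ler_wpM2r // laplacian_row_norm.
Qed.

Lemma card_le_of_counts (K : nat) G H :
  count_below_le K (spectrum R G) (spectrum R H) -> (#|G| <= #|H| + K)%N.
Proof.
have full L : count (fun a : R => (a <= 2)%R) (spectrum R L) = #|L|.
  rewrite -(size_spectrum L); apply/eqP; rewrite -all_count; apply/allP => a.
  by move/spectrum_bounded; rewrite ler_norml => /andP[].
by case/(_ 2); rewrite !full.
Qed.

(** The entries of the symmetrized Laplacian depend only on adjacency and on
    the degrees in the whole graph, so T must preserve the ambient degrees, not
    those of the induced subgraph. *)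
Lemma common_subgraph_count G H (T : finType) (i : T -> G) (j : T -> H) :
  injective i -> injective j ->
  (forall x, degree (i x) = degree (j x)) ->
  (forall x y, edge (i x) (i y) = edge (j x) (j y)) ->
  count_below_le (#|G| - #|T|) (spectrum R G) (spectrum R H).
Proof.
move=> inji injj degE edgeE; rewrite !spectrumE.
apply: (@compression_count_below _ _ _ _ _ _
  (fun u : 'I_#|T| => enum_rank (i (enum_val u)))
  (fun u : 'I_#|T| => enum_rank (j (enum_val u)))).
- by move=> u v /enum_rank_inj /inji /enum_val_inj.
- by move=> u v /enum_rank_inj /injj /enum_val_inj.
- exact: sym_laplacian_mx_tr.
- exact: sym_laplacian_mx_tr.
- by move=> u v; rewrite !sym_laplacian_mxE !degE edgeE !inj_eq.
Qed.

Definition spectra_close (K : nat) G H : Prop :=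
  count_below_le K (spectrum R G) (spectrum R H) /\
  count_below_le K (spectrum R H) (spectrum R G).

Lemma spectra_close_sym K G H : spectra_close K G H -> spectra_close K H G.
Proof. by case. Qed.

Lemma count_below_leW K K' (s s' : seq R) : (K <= K')%N ->
  count_below_le K s s' -> count_below_le K' s s'.
Proof. by move=> KK' c t; have [? ?] := c t; split; lia. Qed.

Lemma count_below_le_trans K1 K2 (s1 s2 s3 : seq R) :
  count_below_le K1 s1 s2 -> count_below_le K2 s2 s3 ->
  count_below_le (K1 + K2) s1 s3.
Proof. by move=> c1 c2 t; have [? ?] := c1 t; have [? ?] := c2 t; split; lia. Qed.

Lemma common_subgraph_close K G H (T : finType) (i : T -> G) (j : T -> H) :
  (#|G| <= #|T| + K)%N -> (#|H| <= #|T| + K)%N ->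
  injective i -> injective j ->
  (forall x, degree (i x) = degree (j x)) ->
  (forall x y, edge (i x) (i y) = edge (j x) (j y)) ->
  spectra_close K G H.
Proof.
move=> cG cH inji injj degE edgeE; split.
  by apply: count_below_leW (common_subgraph_count inji injj degE edgeE); lia.
apply: count_below_leW (common_subgraph_count injj inji _ _) => //; lia.
Qed.

Lemma degree_bij G (T : finType) (f : T -> G) (x : G) :
  bijective f -> degree x = #|[set z | edge x (f z)]|.
Proof.
move=> bijf; rewrite -(card_imset _ (bij_inj bijf)).
have [g fK gK] := bijf; apply: eq_card => y; rewrite inE; apply/idP/imsetP.
  by move=> xy; exists (g y); rewrite ?inE gK.
by case=> z; rewrite inE => xz ->.
Qed.

Lemma graph_iso_close G H : graph_iso G H -> spectra_close 0 G H.
Proof.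
case=> f [bijf edgef]; have injf := bij_inj bijf.
apply: (@common_subgraph_close _ _ _ G id f) => //.
- by rewrite addn0.
- by rewrite addn0 (bij_eq_card bijf).
by move=> x; rewrite (degree_bij _ bijf); apply: eq_card => y; rewrite !inE edgef.
Qed.

Lemma edge_insertion_close G H : edge_insertion G H -> spectra_close 2 G H.
Proof.
case=> a [b [f [ab _ bijf edgef]]]; have injf := bij_inj bijf.
(* Only the two endpoints of the new edge change degree. *)
pose T := {x : G | (x != a) && (x != b)}.
have cT : (#|G| <= #|{: T}| + 2)%N.
  rewrite card_sig -(cardC [pred x | (x != a) && (x != b)]) leq_add2l.
  have <- : #|[set a; b]| = 2%N by rewrite cards2 ab.
  apply: subset_leq_card; apply/fintype.subsetP => x; rewrite !inE.
  by rewrite negb_and !negbK.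
apply: (@common_subgraph_close _ _ _ T val (f \o val)) => //.
- by rewrite -(bij_eq_card bijf).
- exact: inj_comp injf val_inj.
- case=> x /= /andP[/negPf xa /negPf xb]; rewrite (degree_bij _ bijf).
  by apply: eq_card => y; rewrite !inE edgef xa xb !orbF.
case=> x /= /andP[/negPf xa /negPf xb]; case=> y /= _.
by rewrite edgef xa xb !orbF.
Qed.

Lemma isolated_vertex_insertion_close G H :
  isolated_vertex_insertion G H -> spectra_close 1 G H.
Proof.
case=> f [bijf edgef]; have injf := bij_inj bijf.
apply: (@common_subgraph_close _ _ _ G id (f \o Some)) => //.
- by rewrite addn1.
- by rewrite -(bij_eq_card bijf) card_option addn1.
- exact: inj_comp injf (@Some_inj _).
- move=> x; rewrite (degree_bij _ bijf) /=.
  rewrite /degree -(card_imset _ (@Some_inj _)); apply: eq_card => -[y|].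
    by rewrite !inE edgef (mem_imset _ _ (@Some_inj _)) inE.
  by rewrite !inE edgef; apply/imsetP => -[].
by move=> x y /=; rewrite edgef.
Qed.

Lemma edit_step_close G H : edit_step G H -> spectra_close 2 G H.
Proof.
have W G1 G2 : spectra_close 1 G1 G2 -> spectra_close 2 G1 G2.
  by case=> ? ?; split; apply: count_below_leW (_ : 1 <= 2)%N _.
case=> [/edge_insertion_close|/edge_insertion_close/spectra_close_sym||] //.
- by move/isolated_vertex_insertion_close/W.
- by move/isolated_vertex_insertion_close/W/spectra_close_sym.
Qed.

Lemma edit_within_close C G H : edit_within C G H -> spectra_close (C * 2) G H.
Proof.
case=> k kC stepsk.
suff [c1 c2] : spectra_close (k * 2) G H.
  by split; apply: count_below_leW (_ : k * 2 <= C * 2)%N _ => //; rewrite leq_mul2r kC.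
elim: k G stepsk {kC} => [|k IHk] G /=; first exact: graph_iso_close.
case=> K /edit_step_close [GK KG] /IHk [KH HK]; split; rewrite mulSn.
  exact: count_below_le_trans GK KH.
by rewrite addnC; exact: count_below_le_trans HK KG.
Qed.

End GraphSpectrum.

(** * From level sets to sums *)

Section LevelSets.
Set Implicit Arguments.
Unset Strict Implicit.
Variable R : realType.

(** A discrete layer-cake argument, by removing the largest element a of s.
    While K is positive, a is paid for by one of the K copies of M, and all the
    level counts at heights up to a drop by one.  Once K is 0, either a <= 0 and
    the claim is a matter of signs, or some element of s' is at least a and the
    two are removed together. *)
Lemma sum_le_of_level_counts_sorted (M : R) (K : nat) (s s' : seq R) :
  0 <= M -> sorted >=%R s -> {in s, forall a, a <= M} ->
  {in s', forall a, 0 <= a} ->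
  (forall u, 0 < u -> (count (>= u) s <= count (>= u) s' + K)%N) ->
  \sum_(a <- s) a <= \sum_(a <- s') a + K%:R * M.
Proof.
move=> M0; elim: s s' K => [|a s IHs] s' K.
  move=> _ _ s'0 _; rewrite big_nil addr_ge0 ?mulr_ge0 //.
  by rewrite big_seq sumr_ge0.
rewrite /= (path_sortedE (rev_trans le_trans)) => /andP[/allP sa sorts] sM s'0 cnt.
have aM : a <= M by apply: sM; rewrite mem_head.
have sM' : {in s, forall b, b <= M} by move=> b bs; apply: sM; rewrite in_cons bs orbT.
have cnt0 u : a < u -> count (>= u) s = 0%N.
  move=> au; apply/eqP; rewrite -leqn0 leqNgt -has_count; apply/hasPn => b /sa.
  by rewrite /= -ltNge => /le_lt_trans; apply.
rewrite big_cons; case: K cnt => [|K] cnt.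
  have [a0|a0] := leP a 0.
    rewrite mul0r addr0; apply: (@le_trans _ _ 0); last by rewrite big_seq sumr_ge0.
    rewrite -[leRHS]addr0 lerD // big_seq sumr_le0 // => b /sa /= ba.
    exact: le_trans ba a0.
  have : has (>= a) s'.
    by have := cnt _ a0; rewrite has_count /= lexx addn0; apply: leq_trans.
  case/hasP => b bs' /= ab; have pb := perm_to_rem bs'.
  rewrite (perm_big _ pb) big_cons -addrA lerD //; apply: IHs => //.
    by move=> c /mem_rem; apply: s'0.
  move=> u u0; have [ua|au] := leP u a; last by rewrite cnt0.
  have := cnt _ u0; rewrite (permP pb) /= ua (le_trans ua ab); lia.
rewrite addrC mulrSr mulrDl mul1r addrA lerD //; apply: IHs => //.
move=> u u0; have [ua|au] := leP u a; last by rewrite cnt0.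
have := cnt _ u0; rewrite /= ua; lia.
Qed.

Lemma sum_le_of_level_counts (I : eqType) (M : R) (K : nat) (g : I -> R)
    (s s' : seq I) :
  0 <= M -> {in s, forall a, g a <= M} -> {in s', forall a, 0 <= g a} ->
  (forall u, 0 < u ->
    (count (fun a => (u <= g a)%R) s <= count (fun a => (u <= g a)%R) s' + K)%N) ->
  \sum_(a <- s) g a <= \sum_(a <- s') g a + K%:R * M.
Proof.
move=> M0 gM g0 cnt.
rewrite -!(big_map g predT id) -(perm_big _ (permEl (perm_sort >=%R _))).
apply: sum_le_of_level_counts_sorted => //.
- by apply: sort_sorted => x y; exact: le_total.
- by move=> a; rewrite mem_sort => /mapP[b bs ->]; apply: gM.
- by move=> a /mapP[b bs ->]; apply: g0.
by move=> u u0; rewrite count_sort !count_map; exact: cnt.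
Qed.

Lemma count_segment (s : seq R) (x y : R) : x <= y ->
  (count (fun a => (x <= a <= y)%R) s + count (fun a => (a < x)%R) s =
  count (fun a => (a <= y)%R) s)%N.
Proof.
move=> xy; elim: s => //= a s IHs; rewrite -IHs.
have [ax|xa] := ltP a x; last by rewrite /=; lia.
by rewrite (le_trans (ltW ax) xy) /=; lia.
Qed.

Lemma count_segment_le (K : nat) (s s' : seq R) (x y : R) :
  count_below_le K s s' -> count_below_le K s' s ->
  (count (fun a => (x <= a <= y)%R) s <=
   count (fun a => (x <= a <= y)%R) s' + K * 2)%N.
Proof.
move=> c c'; have [xy|yx] := leP x y; last first.
  rewrite (eq_count (a2 := pred0)) ?count_pred0 // => a /=.
  by apply/negbTE/negP => /andP[xa ay]; have := le_trans xa ay; rewrite leNgt yx.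
have := count_segment s xy; have := count_segment s' xy.
by have [+ _] := c y; have [_ +] := c' x; lia.
Qed.

End LevelSets.

(** * Gaussian smoothing of the spectrum *)

Section Gaussian.
Set Implicit Arguments.
Unset Strict Implicit.
Variable R : realType.

(** The density decreases with the distance from x to the centre a; a height u
    above the peak is covered by a negative radius, that is an empty interval. *)
Lemma normal_pdf_level (s x u : R) : s != 0 -> 0 < u ->
  (exists r, forall a, (u <= normal_pdf a s x) = (x - r <= a <= x + r)).
Proof.
move=> s0 u0; have s2 : 0 < s ^+ 2 *+ 2 by rewrite mulrn_wgt0 // exprn_even_gt0.
have P0 := normal_peak_gt0 s0.
pose q := - (s ^+ 2 *+ 2 * ln (u / normal_peak s)).
have lev a : (u <= normal_pdf a s x) = ((x - a) ^+ 2 <= q).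
  rewrite normal_pdfE // /normal_fun -ler_pdivrMl // [_^-1 * u]mulrC.
  rewrite -[leLHS]lnK ?posrE ?divr_gt0 // ler_expR ler_pdivlMr // lerNr.
  by rewrite /q [ln _ * _]mulrC.
have [q0|q0] := leP 0 q.
  exists (Num.sqrt q) => a; rewrite lev -ler_distl -{1}(sqr_sqrtr q0).
  rewrite -[in RHS]ler_sqr ?nnegrE ?sqrtr_ge0 //.
  by rewrite real_normK ?num_real // -[in RHS]sqrrN opprB.
exists (-1) => a; rewrite lev; apply/idP/idP => [h|/andP[]]; last lra.
by have := le_lt_trans h q0; rewrite ltNge sqr_ge0.
Qed.

(** An integrable upper bound for all Gaussians of width s centred in [-2, 2]:
    doubling the width absorbs the shift of the centre, up to a constant
    factor. *)
Definition normal_majorant (s x : R) : R :=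
  2 * expR (s ^+ 2)^-1 * normal_pdf 0 (2 * s) x.

Lemma normal_pdf_le_majorant (s a x : R) : s != 0 -> `|a| <= 2 ->
  normal_pdf a s x <= normal_majorant s x.
Proof.
move=> s0 a2; have ss0 : 2 * s != 0 by rewrite mulf_neq0.
have s2 : 0 < s ^+ 2 by rewrite exprn_even_gt0.
rewrite /normal_majorant !normal_pdfE // /normal_fun subr0.
have -> : normal_peak s = 2 * normal_peak (2 * s).
  have four : (2 * s) ^+ 2 * pi *+ 2 = 2 ^+ 2 * (s ^+ 2 * pi *+ 2).
    by rewrite exprMn -mulrA mulrnAr.
  rewrite /normal_peak four sqrtrM ?exprn_even_ge0 // sqrtr_sqr ger0_norm //.
  by rewrite invfM mulrA divff // mul1r.
(* The exponents compare because (x - a) ^ 2 / 2 + 1 - x ^ 2 / 8 equals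
   (3 x - 4 a) ^ 2 / 24 + (4 - a ^ 2) / 6 + 1 / 3. *)
rewrite -!mulrA ler_pM2l // mulrCA ler_pM2l ?normal_peak_gt0 // -expRD ler_expR.
have a4 : a ^+ 2 <= 4.
  by rewrite -real_normK ?num_real // (_ : 4 = 2 ^+ 2) ?ler_sqr ?nnegrE // -natrX.
have -> : (s ^+ 2)^-1 + - x ^+ 2 / ((2 * s) ^+ 2 *+ 2) =
   (1 - x ^+ 2 / 8) / s ^+ 2 by field.
have -> : - (x - a) ^+ 2 / (s ^+ 2 *+ 2) = (- (x - a) ^+ 2 / 2) / s ^+ 2 by field.
by rewrite ler_pM2r ?invr_gt0 //; have := sqr_ge0 (3 * x - 4 * a); nra.
Qed.

Lemma normal_majorant_ge0 (s x : R) : 0 <= normal_majorant s x.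
Proof. by rewrite !mulr_ge0 ?expR_ge0 ?normal_pdf_ge0. Qed.

(** Of the three multiples of K, two come from the level intervals, whose two
    endpoints each cost K, and one from replacing 1/n' by 1/n in front of the
    second sum, since |n - n'| <= K. *)
Lemma spectral_density_diff (s : R) (K : nat) (G H : sgraph) (x : R) : s != 0 ->
  (0 < #|G|)%N -> (0 < #|H|)%N ->
  spectra_close R K G H ->
  `|spectral_density s G x - spectral_density s H x| <=
  #|G|%:R^-1 * ((K * 3)%:R * normal_majorant s x).
Proof.
move=> s0 G0 H0 [cGH cHG]; set M := normal_majorant s x.
have M0 : 0 <= M := normal_majorant_ge0 _ _.
have bd L a : a \in spectrum R L -> normal_pdf a s x <= M.
  by move=> aL; apply: normal_pdf_le_majorant => //; exact: spectrum_bounded aL.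
have half L L' : count_below_le K (spectrum R L) (spectrum R L') ->
    count_below_le K (spectrum R L') (spectrum R L) ->
    \sum_(a <- spectrum R L) normal_pdf a s x <=
    \sum_(a <- spectrum R L') normal_pdf a s x + (K * 2)%:R * M.
  move=> c c'; apply: sum_le_of_level_counts => //.
  - exact: bd.
  - by move=> a _; exact: normal_pdf_ge0.
  move=> u u0; have [r lev] := normal_pdf_level x s0 u0.
  by rewrite !(eq_count lev); exact: count_segment_le.
have S'M : \sum_(a <- spectrum R H) normal_pdf a s x <= #|H|%:R * M.
  rewrite -(size_spectrum R H) -sum1_size natr_sum mulr_suml big_seq [leRHS]big_seq.
  by apply: ler_sum => a aH; rewrite mul1r; exact: bd aH.
have S'0 : 0 <= \sum_(a <- spectrum R H) normal_pdf a s x.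
  by apply: sumr_ge0 => a _; exact: normal_pdf_ge0.
move: (half _ _ cGH cHG) (half _ _ cHG cGH).
move: (card_le_of_counts cGH) (card_le_of_counts cHG) S'M S'0.
rewrite /spectral_density.
set S := \sum_(a <- spectrum R G) _; set S' := \sum_(a <- spectrum R H) _.
rewrite -!(ler_nat R) !natrD !natrM; set n := #|G|%:R; set n' := #|H|%:R.
have n0 : 0 < n by rewrite ltr0n.
have n'0 : 0 < n' by rewrite ltr0n.
move=> ? ? ? ? ? ?.
have -> : n^-1 * S - n'^-1 * S' = n^-1 * (S - S' + (n' - n) * (S' / n')).
  field. by rewrite !gt_eqF.
rewrite normrM gtr0_norm ?invr_gt0 // ler_pM2l ?invr_gt0 //.
have T0 : 0 <= S' / n' by rewrite divr_ge0 // ltW.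
have TM : S' / n' <= M by rewrite ler_pdivrMr // mulrC.
apply: le_trans (ler_normD _ _) _; rewrite normrM (ger0_norm T0).
have d1 : `|S - S'| <= K%:R * 2 * M by rewrite ler_norml; apply/andP; split; lra.
have d2 : `|n' - n| <= K%:R by rewrite ler_norml; apply/andP; split; lra.
have d3 : `|n' - n| * (S' / n') <= K%:R * M by apply: ler_pM.
lra.
Qed.

Lemma measurable_spectral_density (s : R) (G : sgraph) :
  measurable_fun setT (spectral_density s G).
Proof.
apply: measurable_funM => //; apply: measurable_sum => a.
exact: measurable_normal_pdf.
Qed.

Lemma spectral_distance_le (s : R) (K : nat) (G H : sgraph) : s != 0 ->
  (0 < #|G|)%N -> (0 < #|H|)%N -> spectra_close R K G H ->
  0 <= spectral_distance s G H <=
    (K * 3)%:R * (2 * expR (s ^+ 2)^-1) * #|G|%:R^-1.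
Proof.
move=> s0 G0 H0 cl; apply/andP; split; first exact: Rintegral_ge0.
set c := leRHS.
have c0 : 0 <= c by rewrite !mulr_ge0 ?expR_ge0 ?invr_ge0.
have intle : (\int[@lebesgue_measure R]_x
    (`|spectral_density s G x - spectral_density s H x|)%:E <= c%:E)%E.
  have <- : (\int[@lebesgue_measure R]_x (c%:E * (normal_pdf 0 (2 * s) x)%:E) = c%:E)%E.
    rewrite ge0_integralZl_EFin //.
    - by rewrite integral_normal_pdf mule1.
    - by move=> x _; rewrite lee_fin normal_pdf_ge0.
    by apply/measurable_EFinP; exact: measurable_normal_pdf.
  apply: ge0_le_integral => //.
  - apply/measurable_EFinP; apply: measurableT_comp => //.
    by apply: measurable_funB; exact: measurable_spectral_density.
  - apply: emeasurable_funM => //; apply/measurable_EFinP.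
    exact: measurable_normal_pdf.
  move=> x _; rewrite -EFinM lee_fin.
  apply: le_trans (spectral_density_diff x s0 G0 H0 cl) _.
  by rewrite /normal_majorant /c mulrC !mulrA (mulrAC _ _ (#|G|%:R^-1)).
rewrite /spectral_distance /Rintegral -lee_fin fineK //.
rewrite ge0_fin_numE; first exact: le_lt_trans intle (ltry _).
by apply: integral_ge0 => x _; rewrite lee_fin.
Qed.

End Gaussian.

Local Open Scope classical_set_scope.
Local Open Scope ring_scope.

Theorem theorem3p2 (R : realType) (sigma : R) (C : nat) (G G' : nat -> sgraph)
  (sigma_gt0 : 0 < sigma)
  (card_G : forall n : nat, #|G n| = n)
  (edit_G : forall n : nat, edit_within C (G n) (G' n)) :
  (fun n : nat => spectral_distance sigma (G n) (G' n))
    =O_\oo (fun n : nat => n%:R^-1 : R).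
Proof.
pose c : R := (C * 2 * 3)%:R * (2 * expR (sigma ^+ 2)^-1).
apply/eqOP; near=> k; near=> n.
(* Each edit costs at most two vertices in the comparison, so n > 2 C keeps the
   vertex set of G' n nonempty. *)
have Cn : (C * 2 < n)%N by near: n; exact: nbhs_infty_gt.
have ck : c <= k by near: k; apply: nbhs_pinfty_ge; rewrite num_real.
have close := edit_within_close R (edit_G n).
have card_le := card_le_of_counts close.1.
have := @spectral_distance_le _ sigma _ _ _ (lt0r_neq0 sigma_gt0) _ _ close.
rewrite card_G in card_le *; case/(_ _ _)/andP => [||d0 dle]; try lia.
rewrite !ger0_norm ?invr_ge0 //; apply: le_trans dle _.
by rewrite -/c ler_wpM2r ?invr_ge0.
Unshelve. all: by end_near.
Qed.
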